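(* Let $L^{(1)},\dots,L^{(n)}$ and $M$ be polytopes in standard form and let $f_i\colon L^{(i)}\to M$ ($1\le i\le n$) be affine maps. Let $$x=(x^{(1)},\dots,x^{(n)})\in L^{(1)}\times_M\cdots\times_M L^{(n)}:=\{(y^{(1)},\dots,y^{(n)})\in L^{(1)}\times\cdots\times L^{(n)}:\ f_1(y^{(1)})=\cdots=f_n(y^{(n)})\}.$$ For each $1\le i\le n$ define $A_i:=\{f_i(y):\ y\in \operatorname{Vsupp}(x^{(i)})\}$. Suppose that (1) for every $1\le i\le n$, the restriction of $f_i$ to $\operatorname{Vsupp}(x^{(i)})$ is injective (equivalently $|A_i|=|\operatorname{Vsupp}(x^{(i)})|$) and the set $A_i$ is affinely independent; and (2) the intersection $\bigcap_{i=1}^n\operatorname{Conv}(A_i)$ consists of a single point. Then $x$ is a vertex of the fiber product $L^{(1)}\times_M\cdots\times_M L^{(n)}$.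
   Context: A polytope in standard form is a bounded set $L=\{x\in\mathbb{R}^N: Ax=b,\ x_i\ge 0\ \forall i\}$ for a real matrix $A$ and vector $b$. A vertex of $L$ is a point that is not a nontrivial convex combination of two distinct points of $L$. For $x\in L$, $\operatorname{supp}(x)=\{i: x_i\neq 0\}$; for $x,y\in L$ write $y\preceq x$ if $\operatorname{supp}(y)\subseteq\operatorname{supp}(x)$. The vertex support $\operatorname{Vsupp}(x)$ is the set of vertices $y$ of $L$ with $y\preceq x$. $\operatorname{Conv}$ denotes convex hull. The fiber product is regarded as a subset of the product of the ambient Euclidean spaces (it is again a polytope in standard form). *)

(* Defs.v *)
From HB Require Import structures.
From mathcomp Require Import all_boot all_order all_algebra.
From mathcomp Require Import all_classical all_reals all_analysis.

Set Implicit Arguments.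
Unset Strict Implicit.
Unset Printing Implicit Defensive.

Import Order.TTheory GRing.Theory Num.Theory.
Import numFieldNormedType.Exports.

Local Open Scope classical_set_scope.
Local Open Scope ring_scope.

Definition standard_polytope (R : realType) (N : nat) (L : set 'cV[R]_N) :=
  bounded_set L /\
  exists (m : nat) (A : 'M[R]_(m, N)) (b : 'cV[R]_m),
    L = [set x | A *m x = b /\ forall i, 0 <= x i 0].

Definition vertex (R : realType) (V : lmodType R) (L : set V) : set V :=
  [set x | L x /\
    forall (y z : V) (t : R), L y -> L z -> y <> z -> 0 < t < 1 ->
      x <> t *: y + (1 - t) *: z].

Definition supp (R : realType) (N : nat) (x : 'cV[R]_N) : set 'I_N :=
  [set i | x i 0 != 0].

Definition Vsupp (R : realType) (N : nat) (L : set 'cV[R]_N) (x : 'cV[R]_N) :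
    set 'cV[R]_N :=
  [set y | vertex L y /\ supp y `<=` supp x].

Definition Conv (R : realType) (V : lmodType R) (A : set V) : set V :=
  smallest (@convex_set R V) A.

(* The families p are injective, so this is a condition on the set A: no finite
   subset of A satisfies a nontrivial affine relation. *)
Definition affinely_independent (R : realType) (V : lmodType R) (A : set V) :=
  forall (k : nat) (p : 'I_k -> V) (c : 'I_k -> R),
    injective p -> (forall j, A (p j)) ->
    \sum_(j < k) c j = 0 -> \sum_(j < k) c j *: p j = 0 ->
    forall j, c j = 0.

(* f is constrained only on L: its values elsewhere are irrelevant. *)
Definition affine_on (R : realType) (V W : lmodType R) (L : set V)
    (f : V -> W) :=
  forall (y z : V) (t : R), L y -> L z -> 0 <= t <= 1 ->
    f (t *: y + (1 - t) *: z) = t *: f y + (1 - t) *: f z.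

(* The product of the ambient spaces R^(N i) is the space of column vectors of
   size \sum_i N i; the i-th component of such a vector y is submxcol y i. *)
Definition fiber_product (R : realType) (n : nat) (N : 'I_n -> nat) (K : nat)
    (L : forall i, set 'cV[R]_(N i)) (f : forall i, 'cV[R]_(N i) -> 'cV[R]_K) :
    set 'cV[R]_(\sum_(i < n) N i) :=
  [set y | (forall i, L i (submxcol y i)) /\
    forall i j, f i (submxcol y i) = f j (submxcol y j)].

(* Main.v *)
(* A point y of a standard-form polytope L lies in the convex hull of its vertex
   support: if y is not a vertex, it is interior to a segment of L, and since L
   is bounded, the line of that segment leaves L on both sides at points of
   strictly smaller support, so induction on the support size applies.
   If x = t y + (1 - t) z in the fiber product with 0 < t < 1, nonnegativity
   makes the supports of y and z lie in that of x, so each component y_i, z_i is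
   in the hull of Vsupp(x_i). The common value of the f_i(y_i) thus lies in every
   Conv(A_i), hence is the unique point p, and likewise for z. As A_i is affinely
   independent and f_i is injective on Vsupp(x_i), f_i is injective on the hull,
   whence y_i = z_i. *)

Require Import Defs.
From HB Require Import structures.
From mathcomp Require Import all_boot all_order all_algebra.
From mathcomp Require Import all_classical all_reals all_analysis.
From mathcomp Require Import ring.

Set Implicit Arguments.
Unset Strict Implicit.
Unset Printing Implicit Defensive.

Import Order.TTheory GRing.Theory Num.Theory.
Import numFieldNormedType.Exports.

Local Open Scope classical_set_scope.
Local Open Scope ring_scope.

(** * Convex sets and convex hulls *)

Lemma convex_setP (R : realType) (V : lmodType R) (A : set V) :
  @convex_set R V A <->
  forall (y z : V) (t : R), A y -> A z -> 0 <= t <= 1 ->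
    A (t *: y + (1 - t) *: z).
Proof.
split=> [cA y z t Ay Az /andP[t0 t1]|cA y z t].
  have := cA y z (Itv01 t0 t1); rewrite !inE; exact.
by rewrite !inE => Ay Az; apply: cA => //; rewrite ge0 le1.
Qed.

(** Serves as the induction principle for hulls. *)
Lemma Conv_min (R : realType) (V : lmodType R) (A H : set V) :
  @convex_set R V H -> A `<=` H -> Conv A `<=` H.
Proof. by move=> cH AH y; apply; split. Qed.

Lemma Conv_convex (R : realType) (V : lmodType R) (A : set V) :
  @convex_set R V (Conv A).
Proof.
apply/convex_setP => y z t Ay Az t01 H [cH AH].
by move/convex_setP: (cH); apply => //; [apply: Ay|apply: Az].
Qed.

Lemma subset_Conv (R : realType) (V : lmodType R) (A B : set V) :
  A `<=` B -> Conv A `<=` Conv B.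
Proof.
by move=> AB; apply: Conv_min => [|y Ay H [_]]; [exact: Conv_convex|apply; exact: AB].
Qed.

(** * Standard-form polytopes: recession directions, exit points, vertex supports *)

Lemma standard_polytope_convex (R : realType) (N : nat) (L : set 'cV[R]_N) :
  standard_polytope L -> @convex_set R 'cV[R]_N L.
Proof.
move=> [_ [m [A [b ->]]]]; apply/convex_setP => y z t [Ay y0] [Az z0].
move=> /andP[t0 t1]; split=> [|i].
  by rewrite mulmxDr -!scalemxAr Ay Az -scalerDl addrC subrK scale1r.
by rewrite !mxE addr_ge0// mulr_ge0// subr_ge0.
Qed.

(** If [d] had a positive coordinate, the whole ray [y + s *: d] with [s >= 0] would stay in the
    polytope while that coordinate grows without bound. *)
Lemma bounded_recession (R : realType) (N m : nat) (A : 'M[R]_(m, N))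
    (b : 'cV[R]_m) (y d : 'cV[R]_N) :
  bounded_set [set x : 'cV[R]_N | A *m x = b /\ forall i, 0 <= x i 0] ->
  A *m y = b -> (forall i, 0 <= y i 0) ->
  A *m d = 0 -> (forall i, 0 <= d i 0) -> d = 0.
Proof.
move=> [M [_ Mb]] Ay y0 Ad d0; apply/matrixP => i j; rewrite ord1 mxE {j}.
apply/eqP/negPn/negP => di0.
have di : 0 < d i 0 by rewrite lt_neqAle eq_sym di0 d0.
pose B := `|M| + 1.
have BM : M < B by rewrite ltr_pwDr// ler_norm.
have B0 : 0 < B by rewrite ltr_wpDl.
(* With this step the [i]-th coordinate becomes [y i 0 + B + 1], which exceeds the norm bound
   [B]. *)
pose s := (B + 1) / d i 0.
have s0 : 0 <= s by rewrite divr_ge0// ltW// ltr_wpDr.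
have := Mb B BM (y + s *: d); apply/not_implyP; split.
  split=> [|k]; first by rewrite mulmxDr -scalemxAr Ad scaler0 addr0.
  by rewrite !mxE addr_ge0// mulr_ge0.
apply/negP; rewrite -ltNge.
have : `|(y + s *: d) i 0| <= `|y + s *: d|.
  rewrite [leRHS]/Num.Def.normr /= mx_normrE.
  by apply: (le_bigmax _ (fun ij => `|(y + s *: d) ij.1 ij.2|) (i, 0)).
apply: lt_le_trans; apply: lt_le_trans (ler_norm _).
by rewrite !mxE /s divfK// ltr_wpDl// ltrDl.
Qed.

(** This is the ratio test of the simplex method: boundedness forces a negative coordinate of [d],
    and the least ratio [y i 0 / - d i 0] over such coordinates is the largest step that keeps all
    coordinates nonnegative. The minimising coordinate drops out of the support. *)
Lemma ray_exit (R : realType) (N m : nat) (A : 'M[R]_(m, N))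
    (b : 'cV[R]_m) (y d : 'cV[R]_N) :
  bounded_set [set x : 'cV[R]_N | A *m x = b /\ forall i, 0 <= x i 0] ->
  A *m y = b -> (forall i, 0 <= y i 0) ->
  A *m d = 0 -> d != 0 -> supp d `<=` supp y ->
  exists s : R, [/\ 0 < s, forall i, 0 <= (y + s *: d) i 0 &
    supp (y + s *: d) `<` supp y].
Proof.
move=> bL Ay y0 Ad d0 dy.
have [i0 di0] : exists i, d i 0 < 0.
  apply/not_existsP => dge; move/eqP: d0; apply.
  by apply: bounded_recession bL Ay y0 Ad _ => i; rewrite leNgt; apply/negP.
pose r i := y i 0 / - d i 0.
have [i di rmin] := @arg_minP _ _ _ i0 (fun i => d i 0 < 0) r di0.
(* The inclusion of supports makes the step positive and the loss of [i] from the support strict. *)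
have yi : 0 < y i 0.
  by rewrite lt_neqAle eq_sym y0 andbT; apply: dy; rewrite /supp/= lt_eqF.
exists (r i); split.
- by rewrite divr_gt0// oppr_gt0.
- move=> k; rewrite !mxE; have [dk|dk] := ltP (d k 0) 0; last first.
    by rewrite addr_ge0// mulr_ge0// divr_ge0// oppr_ge0 ltW.
  rewrite -[d k 0]opprK mulrN subr_ge0 -ler_pdivlMr ?oppr_gt0//.
  exact: rmin.
- split=> [k|/(_ i)]; last first.
    rewrite /supp/= gt_eqF// => /(_ isT).
    by rewrite !mxE /r invrN mulrN mulNr divfK ?subrr ?eqxx// lt_eqF.
  rewrite /supp/= !mxE; apply: contra => /eqP yk; rewrite yk add0r.
  have [->|dk] := eqVneq (d k 0) 0; first by rewrite mulr0.
  by have := dy k dk; rewrite /supp/= yk eqxx.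
Qed.

Lemma standard_polytope_Conv_Vsupp (R : realType) (N : nat) (L : set 'cV[R]_N)
    (y : 'cV[R]_N) :
  standard_polytope L -> L y -> Conv (Vsupp L y) y.
Proof.
move=> sL; have [k] := ubnP #|[pred i | y i 0 != 0]|.
elim: k y => // k IH y; rewrite ltnS => yk Ly.
(* A smaller support gives a smaller vertex support, so the hull obtained by induction for [z] lies
   in the one for [y]. *)
have IHy z : L z -> supp z `<` supp y -> Conv (Vsupp L y) z.
  move=> Lz [zy yz].
  have /subset_Conv : Vsupp L z `<=` Vsupp L y.
    by move=> v [vL vz]; split=> //; apply: subset_trans zy.
  apply; apply: IH => //; apply: leq_trans yk; apply: proper_card.
  apply/properP; split; first by apply/fintype.subsetP => i; exact: zy.
  move/existsNP: yz => [i /not_implyP[yi zi]].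
  by exists i; [exact: yi|exact/negP].
have [vy|nvy] := pselect (vertex L y); first by move=> H [_]; apply; split.
have [u [v [t [Lu Lv uv t01 yE]]]] : exists u v t,
    [/\ L u, L v, u <> v, 0 < t < 1 & y = t *: u + (1 - t) *: v].
  apply: contrapT => nex; apply: nvy; split=> // u v t Lu Lv uv t01 yE.
  by apply: nex; exists u, v, t.
have [bL [m [A [b LE]]]] := sL; rewrite LE in bL.
have [Ay y0] : [set x | A *m x = b /\ forall i, 0 <= x i 0] y by rewrite -LE.
move: (Lu) (Lv); rewrite {1 2}LE => -[Au u0] [Av v0].
have /andP[t0] := t01; rewrite -subr_gt0 => t1.
have Ad : A *m (u - v) = 0 by rewrite mulmxBr Au Av subrr.
have d0 : u - v != 0 by rewrite subr_eq0; apply/eqP.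
(* Both weights are positive and [u], [v] are nonnegative, so a zero coordinate of [y] is zero in
   [u] and in [v]. *)
have dy : supp (u - v) `<=` supp y.
  move=> i; rewrite /supp/= yE !mxE; apply: contra.
  rewrite paddr_eq0 ?mulr_ge0 ?(ltW t0) ?(ltW t1)// !mulf_eq0.
  by rewrite (gt_eqF t0) (gt_eqF t1) => /andP[/eqP-> /eqP->]; rewrite subrr.
have [s [s0 ps sy]] := ray_exit bL Ay y0 Ad d0 dy.
have Ad' : A *m (- (u - v)) = 0 by rewrite mulmxN Ad oppr0.
have d0' : - (u - v) != 0 by rewrite oppr_eq0.
have dy' : supp (- (u - v)) `<=` supp y.
  by move=> i; rewrite /supp/= mxE oppr_eq0; exact: dy.
have [r [r0 pr ry]] := ray_exit bL Ay y0 Ad' d0' dy'.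
have rs0 : 0 < r + s by rewrite addr_gt0.
set d := u - v in Ad Ad' ps sy pr ry *.
(* The weights [r / (r + s)] and [s / (r + s)] make the displacements [s *: d] and [- r *: d]
   cancel. *)
have zE : (r / (r + s)) *: (y + s *: d) +
    (1 - r / (r + s)) *: (y + r *: - d) = y.
  rewrite !(scalerDr _ y) addrACA -scalerDl [r / _ + _]addrC subrK scale1r.
  rewrite !scalerN !scalerA -scalerBl.
  suff -> : r / (r + s) * s - (1 - r / (r + s)) * r = 0 by rewrite scale0r addr0.
  by field; rewrite gt_eqF.
have /convex_setP cV := @Conv_convex R _ (Vsupp L y).
rewrite -[X in _ X]zE; apply: cV.
- apply: IHy sy; rewrite LE; split=> //.
  by rewrite mulmxDr -scalemxAr Ad scaler0 addr0.
- apply: IHy ry; rewrite LE; split=> //.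
  by rewrite mulmxDr -scalemxAr Ad' scaler0 addr0.
- by rewrite divr_ge0 ?ltW//= ltr_pdivrMr// mul1r ltrDl.
Qed.

(** * Affine maps on convex hulls *)

Lemma affine_on_Conv (R : realType) (V W : lmodType R) (L B : set V)
    (f : V -> W) :
  @convex_set R V L -> affine_on L f -> B `<=` L ->
  forall y, Conv B y -> Conv (f @` B) (f y).
Proof.
(* Membership in [L] is carried through the induction because [f] is affine only there. *)
move=> cL fL BL y By; suff [] : (L `&` f @^-1` Conv (f @` B)) y by [].
move: y By; apply: Conv_min => [|v Bv]; last first.
  by split; [exact: BL|move=> H [_]; apply; exists v].
apply/convex_setP => y z t [Ly fy] [Lz fz] t01; split.
  by move/convex_setP: cL; apply.
rewrite /preimage/= fL//.
by move/convex_setP: (@Conv_convex R _ (f @` B)); apply.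
Qed.

(** Allows two combinations over different finite lists of points to be rewritten over a common
    list. *)
Lemma sum_uniq_extend (I : choiceType) (V : nmodType) (s s' : seq I)
    (F : I -> V) :
  uniq s -> uniq s' -> {subset s <= s'} -> (forall v, v \notin s -> F v = 0) ->
  \sum_(v <- s) F v = \sum_(v <- s') F v.
Proof.
move=> us us' ss' F0.
have sE : perm_eq s [seq v <- s' | v \in s].
  apply: uniq_perm => [//||v]; first exact: filter_uniq.
  by rewrite mem_filter; case vs: (v \in s) => //=; rewrite ss'.
rewrite (perm_big _ sE) big_filter big_mkcond; apply: eq_bigr => v _.
by case: ifPn => // /F0.
Qed.

(* The coefficients of [y] and [f y] are shared, so that affine independence of
   the values of [f] can be used to compare points of the hull. *)
Lemma affine_on_Conv_sum (R : realType) (V W : lmodType R) (L B : set V)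
    (f : V -> W) (y : V) :
  @convex_set R V L -> affine_on L f -> B `<=` L -> Conv B y ->
  exists (s : seq V) (c : V -> R),
    [/\ uniq s, forall v, v \in s -> B v, forall v, v \notin s -> c v = 0,
        \sum_(v <- s) c v = 1 &
        y = \sum_(v <- s) c v *: v /\ f y = \sum_(v <- s) c v *: f v].
Proof.
move=> cL fL BL.
pose H := [set y | L y /\ exists (s : seq V) (c : V -> R),
    [/\ uniq s, forall v, v \in s -> B v, forall v, v \notin s -> c v = 0,
        \sum_(v <- s) c v = 1 &
        y = \sum_(v <- s) c v *: v /\ f y = \sum_(v <- s) c v *: f v]].
suff BH : Conv B `<=` H by move=> /BH[].
apply: Conv_min => [|v Bv]; last first.
  split; first exact: BL.
  exists [:: v], (fun w => (w == v)%:R); split=> //.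
  - by move=> w; rewrite inE => /eqP->.
  - by move=> w; rewrite inE => /negPf->.
  - by rewrite big_seq1 eqxx.
  - by rewrite !big_seq1 eqxx !scale1r.
apply/convex_setP => u w t [Lu [s1 [c1 [us1 Bs1 c10 c11 [uE fuE]]]]].
move=> [Lw [s2 [c2 [us2 Bs2 c20 c21 [wE fwE]]]]] t01.
split; first by move/convex_setP: cL; apply.
have us := undup_uniq (s1 ++ s2).
have s1s : {subset s1 <= undup (s1 ++ s2)}.
  by move=> v vs; rewrite mem_undup mem_cat vs.
have s2s : {subset s2 <= undup (s1 ++ s2)}.
  by move=> v vs; rewrite mem_undup mem_cat vs orbT.
(* Stated for any [g], as it is used both for the points themselves and for their images under
   [f]. *)
have sumE (T : lmodType R) (g : V -> T) :
    \sum_(v <- undup (s1 ++ s2)) (t * c1 v + (1 - t) * c2 v) *: g v =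
    t *: \sum_(v <- s1) c1 v *: g v + (1 - t) *: \sum_(v <- s2) c2 v *: g v.
  rewrite (sum_uniq_extend us1 us s1s); last by move=> v /c10->; rewrite scale0r.
  rewrite (sum_uniq_extend us2 us s2s); last by move=> v /c20->; rewrite scale0r.
  rewrite !scaler_sumr -big_split; apply: eq_bigr => v _.
  by rewrite scalerDl !scalerA.
exists (undup (s1 ++ s2)), (fun v => t * c1 v + (1 - t) * c2 v); split=> //.
- by move=> v; rewrite mem_undup mem_cat => /orP[/Bs1|/Bs2].
- move=> v; rewrite mem_undup mem_cat negb_or => /andP[/c10-> /c20->].
  by rewrite !mulr0 addr0.
- rewrite big_split /= -!mulr_sumr -(sum_uniq_extend us1 us s1s c10).
  by rewrite -(sum_uniq_extend us2 us s2s c20) c11 c21 !mulr1 addrC subrK.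
- by rewrite (fL _ _ _ Lu Lw t01) fuE fwE !sumE -uE -wE.
Qed.

(** Points of the hull with equal images yield, by subtracting coefficients, an affine relation
    between values of [f] on [B]. Affine independence makes it trivial, so the coefficients
    agree. *)
Lemma affine_on_Conv_inj (R : realType) (V W : lmodType R) (L B : set V)
    (f : V -> W) :
  @convex_set R V L -> affine_on L f -> B `<=` L ->
  {in B &, injective f} -> affinely_independent (f @` B) ->
  {in Conv B &, injective f}.
Proof.
move=> cL fL BL fI fB y z; rewrite !inE => By Bz fyz.
have [s1 [c1 [us1 Bs1 c10 c11 [yE fyE]]]] := affine_on_Conv_sum cL fL BL By.
have [s2 [c2 [us2 Bs2 c20 c21 [zE fzE]]]] := affine_on_Conv_sum cL fL BL Bz.
pose s := undup (s1 ++ s2).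
have us : uniq s by exact: undup_uniq.
have s1s : {subset s1 <= s} by move=> v vs; rewrite mem_undup mem_cat vs.
have s2s : {subset s2 <= s} by move=> v vs; rewrite mem_undup mem_cat vs orbT.
have Bs v : v \in s -> B v by rewrite mem_undup mem_cat => /orP[/Bs1|/Bs2].
have sumB (T : lmodType R) (g : V -> T) : \sum_(v <- s) (c1 v - c2 v) *: g v =
    \sum_(v <- s1) c1 v *: g v - \sum_(v <- s2) c2 v *: g v.
  rewrite (sum_uniq_extend us1 us s1s); last by move=> v /c10->; rewrite scale0r.
  rewrite (sum_uniq_extend us2 us s2s); last by move=> v /c20->; rewrite scale0r.
  by rewrite -sumrB; apply: eq_bigr => v _; rewrite scalerBl.
have nth_s (j : 'I_(size s)) : B (nth y s j) by apply/Bs/mem_nth.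
have c12 (j : 'I_(size s)) : c1 (nth y s j) - c2 (nth y s j) = 0.
  apply: (fB _ (fun j : 'I_(size s) => f (nth y s j))
    (fun j : 'I_(size s) => c1 (nth y s j) - c2 (nth y s j))) => /=.
  (* The values are pairwise distinct since [f] is injective on [B] and [s] has no repetition. *)
  - move=> i k /fI; rewrite !inE => /(_ (nth_s i) (nth_s k)) /eqP.
    by rewrite nth_uniq// => /eqP/val_inj.
  - by move=> i; exists (nth y s i).
  - rewrite -(big_mkord xpredT (fun i => c1 (nth y s i) - c2 (nth y s i))).
    rewrite -(big_nth y xpredT (fun v => c1 v - c2 v)) sumrB.
    rewrite -(sum_uniq_extend us1 us s1s c10) -(sum_uniq_extend us2 us s2s c20).
    by rewrite c11 c21 subrr.
  - rewrite -(big_mkord xpredT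
      (fun i => (c1 (nth y s i) - c2 (nth y s i)) *: f (nth y s i))).
    rewrite -(big_nth y xpredT (fun v => (c1 v - c2 v) *: f v)) sumB.
    by rewrite -fyE -fzE fyz subrr.
apply/eqP; rewrite -subr_eq0 yE zE -(sumB V id) (big_nth y) big_mkord.
by rewrite big1// => j _; rewrite c12 scale0r.
Qed.

Theorem theorem2p22 (R : realType) (n : nat) (N : 'I_n -> nat) (K : nat)
    (L : forall i : 'I_n, set 'cV[R]_(N i)) (M : set 'cV[R]_K)
    (f : forall i : 'I_n, {fun L i >-> M})
    (x : 'cV[R]_(\sum_(i < n) N i)) :
  (forall i, standard_polytope (L i)) ->
  standard_polytope M ->
  (forall i, affine_on (L i) (f i)) ->
  fiber_product L f x ->
  let A := fun i : 'I_n => f i @` Vsupp (L i) (submxcol x i) in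
  (forall i, {in Vsupp (L i) (submxcol x i) &, injective (f i)} /\
             affinely_independent (A i)) ->
  (exists p : 'cV[R]_K, \bigcap_i Conv (A i) = [set p]) ->
  vertex (fiber_product L f) x.
Proof.
move=> sL _ fL Lx A fA [p Ap]; split=> // y z t Ly Lz yz t01 xE; apply: yz.
have cL i := standard_polytope_convex (sL i).
have VL i : Vsupp (L i) (submxcol x i) `<=` L i by move=> v [[]].
have hull w i : fiber_product L f w ->
    supp (submxcol w i) `<=` supp (submxcol x i) ->
    Conv (Vsupp (L i) (submxcol x i)) (submxcol w i).
  move=> [Lw _] wx; have := standard_polytope_Conv_Vsupp (sL i) (Lw i).
  by apply: subset_Conv => v [vL vw]; split=> //; apply: subset_trans wx.
have /andP[t0 t1] := t01; rewrite -subr_gt0 in t1.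
have xi i k : submxcol x i k 0 =
    t * submxcol y i k 0 + (1 - t) * submxcol z i k 0 by rewrite xE !mxE.
have Lge0 w i k : fiber_product L f w -> 0 <= submxcol w i k 0.
  move=> [Lw _]; have [_ [m [B [b LE]]]] := sL i.
  by have := Lw i; rewrite LE => -[].
have xsupp i k : submxcol x i k 0 = 0 ->
    submxcol y i k 0 = 0 /\ submxcol z i k 0 = 0.
  move/eqP; rewrite xi paddr_eq0 ?mulr_ge0 ?Lge0 ?(ltW t0) ?(ltW t1)//.
  by rewrite !mulf_eq0 (gt_eqF t0) (gt_eqF t1) => /andP[/eqP-> /eqP->].
have Cy i : Conv (Vsupp (L i) (submxcol x i)) (submxcol y i).
  by apply: hull => // k; apply: contra => /eqP/xsupp[-> _].
have Cz i : Conv (Vsupp (L i) (submxcol x i)) (submxcol z i).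
  by apply: hull => // k; apply: contra => /eqP/xsupp[_ ->].
have fp w i : fiber_product L f w ->
    (forall j, Conv (Vsupp (L j) (submxcol x j)) (submxcol w j)) ->
    f i (submxcol w i) = p.
  move=> [_ fw] Cw.
  (* For each [j] the value is rewritten as the image of the [j]-th component, which lies in the
     [j]-th hull. *)
  have : (\bigcap_i Conv (A i)) (f i (submxcol w i)).
    move=> j _; rewrite (fw i j).
    exact: affine_on_Conv (cL j) (fL j) (VL j) _ (Cw j).
  by rewrite Ap.
apply/mxcolP => i; have [fI Ai] := fA i.
apply: (affine_on_Conv_inj (cL i) (fL i) (VL i) fI Ai); rewrite ?inE.
- exact: Cy.
- exact: Cz.
- by rewrite (fp y i Ly Cy) (fp z i Lz Cz).
Qed.
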